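(* Let $n$ be a positive integer, let $P\in\mathbb{C}^{n\times n}$ be a projection and let $Q\in\mathbb{C}^{n\times n}$ be an idempotent such that $PQ=Q$. Then $$\|P-Q^\dag\|_F\le \sqrt{2}\cdot\sqrt{1+\|Q^\dag Q-QQ^\dag\|_2^2}\cdot\lambda_{P,Q},$$ where $$\lambda_{P,Q}=\sqrt{\|m(Q)-Q\|_F^2+\mathrm{rank}(P)-\mathrm{rank}(Q)}$$ and $m(Q)$ is the matched projection of $Q$. Moreover, equality in the displayed inequality occurs if and only if $P=Q=P_{\mathcal{R}(Q)}$.
   Context: An idempotent is a matrix $Q$ with $Q^2=Q$; a projection is a Hermitian idempotent ($P=P^*=P^2$). $\mathcal{R}(Q)$ is the column range of $Q$ and $P_{\mathcal{R}(Q)}$ is the (orthogonal) projection from $\mathbb{C}^n$ onto $\mathcal{R}(Q)$. $\|\cdot\|_F$ is the Frobenius norm, $\|\cdot\|_2$ the spectral norm, $A^*$ the conjugate transpose, $A^\dag$ the Moore-Penrose inverse, and $|A|=(A^*A)^{1/2}$ the positive semi-definite square root, so $|Q^*|=(QQ^* )^{1/2}$. For an idempotent $Q\in\mathbb{C}^{n\times n}$ the matched projection is $$m(Q)=\tfrac12\big(|Q^*|+Q^*\big)\,|Q^*|^\dag\,\big(|Q^*|+I_n\big)^{-1}\big(|Q^*|+Q\big),$$ which is known to be a projection. *)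

(* Defs.v *)
From HB Require Import structures.
From mathcomp Require Import all_boot all_order all_algebra.
From mathcomp Require Import boolp classical_sets reals.
From mathcomp Require Import complex.
Set Implicit Arguments.
Unset Strict Implicit.
Unset Printing Implicit Defensive.
Import Order.TTheory GRing.Theory Num.Theory.
Local Open Scope ring_scope.
Local Open Scope sesquilinear_scope.
Local Open Scope classical_set_scope.

(* Matrices act on column vectors; [M ^t*] is the conjugate transpose, and
   [R[i]] is the field of complex numbers over the real numbers [R]. *)

Section Matrices.
Context {C : numClosedFieldType}.

Definition idempotentmx n (Q : 'M[C]_n) : Prop := Q *m Q = Q.

Definition projectionmx n (P : 'M[C]_n) : Prop :=
  P \is hermsymmx /\ idempotentmx P.

(* [0 <= z] in [C] implies that [z] is real. *)
Definition psdmx n (A : 'M[C]_n) : Prop :=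
  A \is hermsymmx /\ forall x : 'cV[C]_n, 0 <= (x^t* *m A *m x) 0 0.

(* Junk value 0 when [A] is not positive semi-definite; see [sqrtmxP] and
   [psd_sqrt_uniq]. *)
Definition sqrtmx n (A : 'M[C]_n) : 'M[C]_n :=
  xget 0 [set X : 'M[C]_n | psdmx X /\ X *m X = A].

Definition absmx n (A : 'M[C]_n) : 'M[C]_n := sqrtmx (A^t* *m A).

Definition penrose m n (A : 'M[C]_(m, n)) (X : 'M[C]_(n, m)) : Prop :=
  [/\ A *m X *m A = A, X *m A *m X = X,
      (A *m X)^t* = A *m X & (X *m A)^t* = X *m A].

(* Moore-Penrose inverse; see [mpinvP] and [penrose_uniq]. *)
Definition mpinv m n (A : 'M[C]_(m, n)) : 'M[C]_(n, m) :=
  xget 0 [set X | penrose A X].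

(* [proj_ortho] projects row vectors onto a row space, hence the two
   transpositions; see [range_projP]. *)
Definition range_proj m n (A : 'M[C]_(m, n)) : 'M[C]_m := (proj_ortho A^T)^T.

(* The inverse is a genuine one; see [psd_add1_unit] and [absmxP]. *)
Definition matched_proj n (Q : 'M[C]_n) : 'M[C]_n :=
  2^-1 *: ((absmx (Q^t*) + Q^t*) *m mpinv (absmx (Q^t*))
           *m invmx (absmx (Q^t*) + 1%:M) *m (absmx (Q^t*) + Q)).

End Matrices.

Section Norms.
Context {R : realType}.

Definition frobenius_norm m n (A : 'M[R[i]]_(m, n)) : R :=
  Num.sqrt (\sum_(i < m) \sum_(j < n) Normc.normc (A i j) ^+ 2).

Definition euclidean_norm n (x : 'cV[R[i]]_n) : R :=
  Num.sqrt (\sum_(i < n) Normc.normc (x i 0) ^+ 2).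

(* The operator norm induced by the Euclidean norm. *)
Definition spectral_norm m n (A : 'M[R[i]]_(m, n)) : R :=
  sup [set euclidean_norm (A *m x)
      | x in [set x : 'cV[R[i]]_n | euclidean_norm x = 1]].

Definition lambda_PQ n (P Q : 'M[R[i]]_n) : R :=
  Num.sqrt (frobenius_norm (matched_proj Q - Q) ^+ 2
            + (\rank P)%:R - (\rank Q)%:R).

End Norms.

Section MatrixFacts.
Context {C : numClosedFieldType}.

Lemma trmxC_mul m n p (A : 'M[C]_(m, n)) (B : 'M[C]_(n, p)) :
  (A *m B)^t* = B^t* *m A^t*.
Proof. by rewrite trmx_mul map_mxM. Qed.

Lemma hermsymmxP n (A : 'M[C]_n) : reflect (A^t* = A) (A \is hermsymmx).
Proof.
by apply: (iffP (is_hermitianmxP _ _ _)); rewrite expr0 scale1r.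
Qed.

Lemma gram_eq0 m n (A : 'M[C]_(m, n)) : A *m A^t* = 0 -> A = 0.
Proof.
move=> h; apply/matrixP => i j; rewrite [RHS]mxE.
have /eqP : (A *m A^t*) i i = 0 by rewrite h mxE.
rewrite mxE psumr_eq0 => [/allP /(_ j (mem_index_enum j))|k _]; last first.
  by rewrite !mxE mul_conjC_ge0.
by rewrite !mxE mul_conjC_eq0 => /eqP.
Qed.

Lemma gram_unit r n (G : 'M[C]_(r, n)) : row_free G -> G *m G^t* \in unitmx.
Proof.
move=> fG; rewrite -row_free_unit -kermx_eq0; apply/eqP.
set K := kermx _; have K0 : K *m (G *m G^t*) = 0 by exact: mulmx_ker.
have : K *m G = 0.
  by apply: gram_eq0; rewrite trmxC_mul !mulmxA -(mulmxA K) K0 mul0mx.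
by move/eqP; rewrite mulmx_free_eq0 // => /eqP.
Qed.

Lemma invmx_trmxC n (A : 'M[C]_n) : A^t* = A -> (invmx A)^t* = invmx A.
Proof. by move=> h; rewrite trmx_inv map_invmx h. Qed.

Lemma penrose_factor m n r (F : 'M[C]_(m, r)) (G : 'M[C]_(r, n)) :
  F^t* *m F \in unitmx -> G *m G^t* \in unitmx ->
  penrose (F *m G)
    (G^t* *m invmx (G *m G^t*) *m invmx (F^t* *m F) *m F^t*).
Proof.
move=> uF uG.
have hG : (G *m G^t*)^t* = G *m G^t* by rewrite trmxC_mul trmxCK.
have hF : (F^t* *m F)^t* = F^t* *m F by rewrite trmxC_mul trmxCK.
have kG := mulmxV uG; have kF := mulVmx uF.
move: (invmx_trmxC hG) (invmx_trmxC hF) kG kF.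
set IG := invmx _; set IF := invmx _ => hIG hIF kG kF.
have AX : (F *m G) *m (G^t* *m IG *m IF *m F^t*) = F *m IF *m F^t*.
  transitivity (F *m (G *m G^t* *m IG) *m IF *m F^t*); first by rewrite !mulmxA.
  by rewrite kG mulmx1.
have XA : (G^t* *m IG *m IF *m F^t*) *m (F *m G) = G^t* *m IG *m G.
  transitivity (G^t* *m IG *m (IF *m (F^t* *m F)) *m G); first by rewrite !mulmxA.
  by rewrite kF mulmx1.
split; rewrite ?AX ?XA.
- transitivity (F *m (IF *m (F^t* *m F)) *m G); first by rewrite !mulmxA.
  by rewrite kF mulmx1.
- transitivity (G^t* *m IG *m (G *m G^t* *m IG) *m IF *m F^t*).
    by rewrite !mulmxA.
  by rewrite kG mulmx1.
- by rewrite !trmxC_mul trmxCK hIF mulmxA.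
- by rewrite !trmxC_mul trmxCK hIG mulmxA.
Qed.

Lemma penrose_ex m n (A : 'M[C]_(m, n)) : exists X, penrose A X.
Proof.
rewrite -(mulmx_base A); eexists; apply: penrose_factor.
  rewrite -{2}[col_base A]trmxCK; apply: gram_unit.
  by rewrite /row_free mxrank_map mxrank_tr; have := col_base_full A.
by apply: gram_unit; exact: row_base_free.
Qed.

Lemma penrose_uniq m n (A : 'M[C]_(m, n)) X Y :
  penrose A X -> penrose A Y -> X = Y.
Proof.
move=> [x1 x2 x3 x4] [y1 y2 y3 y4].
have e1 : A *m X = A *m Y.
  rewrite -x3 -{1}y1 -(mulmxA (A *m Y)) trmxC_mul x3 y3.
  by rewrite mulmxA x1.
have e2 : X *m A = Y *m A.
  by rewrite -x4 -{1}y1 -mulmxA mulmxA trmxC_mul y4 x4 -mulmxA (mulmxA A) x1.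
by rewrite -x2 e2 -mulmxA e1 mulmxA.
Qed.

Lemma mpinvP m n (A : 'M[C]_(m, n)) : penrose A (mpinv A).
Proof. by have [X hX] := penrose_ex A; exact: (xgetPex 0 (ex_intro _ X hX)). Qed.

Lemma psd_spectral n (A : 'M[C]_n) : psdmx A ->
  exists (U : 'M[C]_n) (d : 'rV[C]_n),
    [/\ U \is unitarymx, forall i, 0 <= d 0 i & A = U^t* *m diag_mx d *m U].
Proof.
move=> [hA pA].
have /orthomx_spectralP eA := hermitian_normalmx hA.
have uU := spectral_unitarymx A.
rewrite invmx_unitary // in eA.
exists (spectralmx A), (spectral_diag A); split => // i.
pose e : 'cV[C]_n := delta_mx i 0.
have := pA ((spectralmx A)^t* *m e).
set U := spectralmx A in eA uU *; set d := spectral_diag A in eA *.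
have UU : U *m U^t* = 1%:M by apply/unitarymxP.
have -> : (U^t* *m e)^t* *m A *m (U^t* *m e) = e^t* *m diag_mx d *m e.
  rewrite eA trmxC_mul trmxCK !mulmxA -(mulmxA _ U) UU mulmx1.
  by rewrite -(mulmxA _ U) UU mulmx1.
rewrite -mulmxA -colE trmx_delta map_delta_mx -rowE !mxE.
by rewrite eqxx mulr1n.
Qed.

Lemma trmxC_diag n (d : 'rV[C]_n) :
  (forall i, 0 <= d 0 i) -> (diag_mx d)^t* = diag_mx d.
Proof.
move=> d0; rewrite tr_diag_mx map_diag_mx; congr diag_mx.
by apply/rowP => i; rewrite !mxE; apply/CrealP/ger0_real.
Qed.

Lemma psd_diag n (U : 'M[C]_n) (d : 'rV[C]_n) :
  (forall i, 0 <= d 0 i) -> psdmx (U^t* *m diag_mx d *m U).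
Proof.
move=> d0; split.
  by apply/hermsymmxP; rewrite !trmxC_mul trmxCK trmxC_diag // mulmxA.
move=> x.
have -> : x^t* *m (U^t* *m diag_mx d *m U) *m x
          = (U *m x)^t* *m diag_mx d *m (U *m x).
  by rewrite trmxC_mul !mulmxA.
rewrite mxE; apply: sumr_ge0 => i _.
rewrite mul_mx_diag !mxE mulrAC; apply: mulr_ge0 => //.
by rewrite mulrC mul_conjC_ge0.
Qed.

Lemma psd_gram m n (A : 'M[C]_(m, n)) : psdmx (A^t* *m A).
Proof.
split; first by apply/hermsymmxP; rewrite trmxC_mul trmxCK.
move=> x; rewrite mulmxA -trmxC_mul -mulmxA mxE; apply: sumr_ge0 => i _.
by rewrite !mxE mulrC mul_conjC_ge0.
Qed.

Lemma psd_sqrt_ex n (A : 'M[C]_n) :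
  psdmx A -> exists X, psdmx X /\ X *m X = A.
Proof.
move=> /psd_spectral [U [d [uU d0 ->]]].
have UU : U *m U^t* = 1%:M by apply/unitarymxP.
exists (U^t* *m diag_mx (map_mx sqrtC d) *m U); split.
  by apply: psd_diag => i; rewrite mxE sqrtC_ge0.
rewrite !mulmxA -(mulmxA _ U) UU mulmx1 -(mulmxA _ (diag_mx _) (diag_mx _)).
rewrite mulmx_diag; congr (_ *m diag_mx _ *m _).
by apply/rowP => i; rewrite !mxE -expr2 sqrtCK.
Qed.

Lemma psd_sqrt_uniq n (X Y : 'M[C]_n) :
  psdmx X -> psdmx Y -> X *m X = Y *m Y -> X = Y.
Proof.
move=> /psd_spectral [U [d [uU d0 eX]]] /psd_spectral [V [e [uV e0 eY]]] h.
have UU : U *m U^t* = 1%:M by apply/unitarymxP.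
have VV : V *m V^t* = 1%:M by apply/unitarymxP.
have UU' := mulmx1C UU; have VV' := mulmx1C VV.
pose W := V *m U^t*.
have h2 : W *m diag_mx (\row_i (d 0 i ^+ 2))
          = diag_mx (\row_i (e 0 i ^+ 2)) *m W.
  have sq (a : 'rV[C]_n) :
      diag_mx (\row_i (a 0 i ^+ 2)) = diag_mx a *m diag_mx a.
    by rewrite mulmx_diag; congr diag_mx; apply/rowP => i; rewrite !mxE.
  have eXX : V *m (X *m X) *m U^t* = W *m (diag_mx d *m diag_mx d).
    rewrite eX /W; transitivity (V *m U^t* *m diag_mx d *m (U *m U^t*)
      *m diag_mx d *m (U *m U^t*)); first by rewrite !mulmxA.
    by rewrite UU !mulmx1 !mulmxA.
  have eYY : V *m (Y *m Y) *m U^t* = diag_mx e *m diag_mx e *m W.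
    rewrite eY /W; transitivity ((V *m V^t*) *m diag_mx e *m (V *m V^t*)
      *m diag_mx e *m (V *m U^t*)); first by rewrite !mulmxA.
    by rewrite VV mul1mx mulmx1.
  by rewrite !sq -eXX -eYY h.
have h1 : W *m diag_mx d = diag_mx e *m W.
  apply/matrixP => i j; have := congr1 (fun Z : 'M_n => Z i j) h2.
  rewrite !mul_mx_diag !mul_diag_mx !mxE.
  have [->|W0] := eqVneq (\sum_j0 V i j0 * (U^t*) j0 j) 0; first by rewrite !(mul0r, mulr0).
  by rewrite mulrC => /(mulIf W0) /eqP; rewrite eqrXn2 // => /eqP ->; rewrite mulrC.
have := congr1 (fun Z => V^t* *m Z *m U) h1.
rewrite /W !mulmxA VV' mul1mx -eX -(mulmxA _ _ U) UU' mulmx1 => ->.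
by rewrite eY.
Qed.

Lemma sqrtmxP n (A : 'M[C]_n) :
  psdmx A -> psdmx (sqrtmx A) /\ sqrtmx A *m sqrtmx A = A.
Proof.
move=> pA; have [X hX] := psd_sqrt_ex pA.
by rewrite /sqrtmx; case: xgetP => [_ -> //|/(_ X)].
Qed.

Lemma absmxP n (A : 'M[C]_n) :
  psdmx (absmx A) /\ absmx A *m absmx A = A^t* *m A.
Proof. exact/sqrtmxP/psd_gram. Qed.

Lemma psd_add1_unit n (A : 'M[C]_n) : psdmx A -> A + 1%:M \in unitmx.
Proof.
move=> /psd_spectral [U [d [uU d0 ->]]].
have UU := mulmx1C (unitarymxP uU).
have -> : U^t* *m diag_mx d *m U + 1%:M
          = U^t* *m diag_mx (d + const_mx 1) *m U.
  by rewrite linearD /= mulmxDr mulmxDl diag_const_mx mulmx1 UU.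
rewrite !unitmx_mul (unitarymx_unit uU) andbT.
rewrite unitarymx_unit ?trmxC_unitary //= unitmxE det_diag unitfE.
by apply/prodf_neq0 => i _; rewrite !mxE gt_eqF // ltr_wpDl.
Qed.

Local Notation "B ^!" :=
  (orthomx Num.conj (mx_of_hermitian (hermitian1mx _)) B) :
    matrix_set_scope.
Local Notation "A '_|_ B" := (A%MS <= B^!)%MS : bool_scope.

Lemma range_projP m n (A : 'M[C]_(m, n)) :
  projectionmx (range_proj A) /\ ((range_proj A)^T :=: A^T)%MS.
Proof.
have idP : range_proj A *m range_proj A = range_proj A.
  by rewrite -trmx_mul proj_ortho_proj.
split; last by rewrite /range_proj trmxK; exact: proj_orthoE.
split=> //; apply/hermsymmxP; rewrite /range_proj.
set P := proj_ortho _.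
have /orthomx1P : (P '_|_ 1%:M - P)%MS.
  have := proj_ortho_compl_sub A^T (1%:M : 'M_m); rewrite mul1mx -/P => h.
  rewrite orthomx_sym; apply: submx_trans h _.
  by rewrite submx_ortho -(mul1mx P) proj_ortho_sub.
rewrite linearB /= map_mxB mulmxBr trmx1 map_mx1 mulmx1 => /eqP.
rewrite subr_eq0 => /eqP; rewrite -/(P^t*) => eP.
have hP : P^t* = P by rewrite {1}eP trmxC_mul trmxCK.
by rewrite trmxK -{2}hP; apply/matrixP => i j; rewrite !mxE.
Qed.

End MatrixFacts.

Section NormFacts.
Context {R : realType}.

Lemma euclidean_norm_sqr n (x : 'cV[R[i]]_n) :
  euclidean_norm x ^+ 2 = \sum_(i < n) Normc.normc (x i 0) ^+ 2.
Proof. by rewrite sqr_sqrtr // sumr_ge0 // => i _; exact: sqr_ge0. Qed.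

(* The set of which [spectral_norm A] is the supremum is nonempty and bounded. *)
Lemma spectral_norm_has_sup m n (A : 'M[R[i]]_(m, n)) : (0 < n)%N ->
  has_sup [set euclidean_norm (A *m x)
          | x in [set x : 'cV[R[i]]_n | euclidean_norm x = 1]].
Proof.
have normcE0 (z : R[i]) : (Normc.normc z)%:C%C = `|z| by case: z.
have normc_ge0 (z : R[i]) : 0 <= Normc.normc z by case: z => a b; exact: sqrtr_ge0.
case: n A => // n A _; split.
  exists (euclidean_norm (A *m delta_mx 0 0)), (delta_mx 0 0) => //=.
  rewrite /euclidean_norm (bigD1 0) //= big1 ?addr0 => [|i i0].
    by rewrite mxE !eqxx Normc.normc1 expr1n sqrtr1.
  by rewrite mxE (negbTE i0) Normc.normc0 expr0n.
pose b i := \sum_j Normc.normc (A i j).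
exists (Num.sqrt (\sum_i b i ^+ 2)) => _ [x /= x1 <-].
have x1' j : Normc.normc (x j 0) <= 1.
  rewrite -(@ler_pXn2r _ 2) ?nnegrE // expr1n -[leRHS](expr1n _ 2) -x1.
  rewrite euclidean_norm_sqr (bigD1 j) //= lerDl sumr_ge0 // => k _.
  exact: sqr_ge0.
apply: ler_wsqrtr; apply: ler_sum => i _.
rewrite ler_pXn2r ?nnegrE // ?sumr_ge0 // mxE -lecR normcE0.
apply: le_trans (ler_norm_sum _ _ _) _; rewrite rmorph_sum /=.
apply: ler_sum => j _; rewrite normrM -!normcE0 -rmorphM lecR.
by rewrite -[leRHS]mulr1 ler_wpM2l.
Qed.

End NormFacts.

(* Main.v *)
(** Write [T = |Q^*|], [S = T^+] and [E = T S = Q Q^+], the projection onto the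
    range of [Q], and let [x_i >= 0] be the eigenvalues of [T].  Since
    [T^2 = Q Q^*] and [Q^+ = Q^* S^2], expanding traces gives
    [||P - Q^+||_F^2 = rank P - tr S^2] and
    [||m(Q) - Q||_F^2 = tr T^2 - tr T].  For each [x = x_i > 0],
    [2 (x^2 - x) - (1 - x^-2) = (x - 1)^2 (2 x^2 + 2 x + 1) / x^2 >= 0], so
    summing over [i] yields
    [||P - Q^+||_F^2 - k <= 2 ||m(Q) - Q||_F^2] with [k = rank P - rank Q >= 0],
    and equality forces [T = E], hence [Q = E].  This already gives the bound
    with the factor [sqrt 2] alone; the spectral norm only enlarges it. *)
Require Import Defs.
From mathcomp Require Import all_boot all_order all_algebra.
From mathcomp Require Import reals complex ring lra.
Import Order.TTheory GRing.Theory Num.Theory.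
Local Open Scope ring_scope.
Local Open Scope sesquilinear_scope.

(** * Traces and pseudoinverses under conjugate transposition *)

Section ConjugateTranspose.
Context {C : numClosedFieldType}.

Lemma trmxCD {m n} (A B : 'M[C]_(m, n)) : (A + B)^t* = A^t* + B^t*.
Proof. by rewrite linearD /= map_mxD. Qed.

Lemma trmxCB {m n} (A B : 'M[C]_(m, n)) : (A - B)^t* = A^t* - B^t*.
Proof. by rewrite linearB /= map_mxB. Qed.

Lemma psdmx_trmxC {n} {A : 'M[C]_n} : psdmx A -> A^t* = A.
Proof. by case=> /hermsymmxP. Qed.

Lemma mxtrace_trmxC {n} (A : 'M[C]_n) : \tr (A^t*) = (\tr A)^*.
Proof. by rewrite trace_map_mx mxtrace_tr. Qed.

(** The trace is the sum of all [|A i j| ^+ 2], so it vanishes only if every entry does. *)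
Lemma mxtrace_gram_eq0 {m n} (A : 'M[C]_(m, n)) : \tr (A *m A^t*) = 0 -> A = 0.
Proof.
have normE i : (A *m A^t*) i i = \sum_j `|A i j| ^+ 2.
  by rewrite mxE; apply: eq_bigr => j _; rewrite !mxE normCK.
move=> /eqP; rewrite /mxtrace psumr_eq0 => [/allP h|i _]; last first.
  by rewrite normE sumr_ge0 // => j _; rewrite exprn_ge0.
apply/matrixP => i j; have := h i (mem_index_enum i).
rewrite normE psumr_eq0 => [/allP/(_ j (mem_index_enum j))|k _].
  by rewrite /= expf_eq0 /= normr_eq0 mxE => /eqP.
by rewrite exprn_ge0.
Qed.

(** In a rank factorization E = F G, cancelling the full-rank factors in F G F G = F G gives G F =
    1, of size rank E; then tr (F G) = tr (G F). *)
Lemma mxtrace_idempotent {n} (E : 'M[C]_n) :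
  idempotentmx E -> \tr E = (\rank E)%:R.
Proof.
move=> EE; have GF : row_base E *m col_base E = 1%:M.
  have fF : row_full (col_base E) := col_base_full E.
  apply: (row_full_inj fF); apply: (row_free_inj (row_base_free E)).
  by rewrite mulmx1 mulmxA -(mulmxA (_ *m _)) mulmx_base.
by rewrite -{1}(mulmx_base E) mxtrace_mulC GF mxtrace1.
Qed.

(** The Penrose equations reduce to scalar ones on the diagonal. The convention [0^-1 = 0] is
    exactly what the pseudoinverse needs at zero eigenvalues. *)
Lemma mpinv_unitary_conj {n} (U : 'M[C]_n) (d : 'rV[C]_n) :
  U \is unitarymx -> (forall i, 0 <= d 0 i) ->
  mpinv (U^t* *m diag_mx d *m U)
  = U^t* *m diag_mx (map_mx GRing.inv d) *m U.
Proof.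
move=> /unitarymxP UU d0.
have conjM (D D' : 'M[C]_n) :
    (U^t* *m D *m U) *m (U^t* *m D' *m U) = U^t* *m (D *m D') *m U.
  by rewrite !mulmxA -(mulmxA _ U) UU mulmx1.
have conjC (D : 'M[C]_n) : (U^t* *m D *m U)^t* = U^t* *m D^t* *m U.
  by rewrite !trmxC_mul trmxCK mulmxA.
apply: penrose_uniq (mpinvP _) _.
split; rewrite ?(conjM, conjC) ?mulmx_diag ?trmxC_diag //;
  try (congr (_ *m diag_mx _ *m _); apply/rowP => i; rewrite !mxE).
- have [->|di] := eqVneq (d 0 i) 0; first by rewrite !mulr0.
  by rewrite divff // mul1r.
- have [->|di] := eqVneq (d 0 i) 0; first by rewrite invr0 !mulr0.
  by rewrite mulVf // mul1r.
- by move=> i; rewrite !mxE mulr_ge0 // invr_ge0.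
- by move=> i; rewrite !mxE mulr_ge0 // invr_ge0.
Qed.

End ConjugateTranspose.

(** * Algebra and trace formulas for an idempotent and its [T], [S], [E] *)

Section Idempotent.
Context {C : numClosedFieldType} {n : nat} {Q : 'M[C]_n}.
Hypothesis QQ : idempotentmx Q.

Local Notation T := (absmx (Q^t*)).
Local Notation S := (mpinv T).
Local Notation E := (T *m S).

Lemma absmx_trmxC_sqr : T *m T = Q *m Q^t*.
Proof. by have [_ ->] := absmxP (Q^t*); rewrite trmxCK. Qed.

Lemma absmx_spectral : exists (U : 'M[C]_n) (d : 'rV[C]_n),
  [/\ U \is unitarymx, forall i, 0 <= d 0 i, T = U^t* *m diag_mx d *m U
    & S = U^t* *m diag_mx (map_mx GRing.inv d) *m U].
Proof.
have [pT _] := absmxP (Q^t*).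
have [U [d [uU d0 eT]]] := psd_spectral pT; exists U, d; split=> //.
by rewrite {1}eT mpinv_unitary_conj.
Qed.

Let TC : T^t* = T.
Proof. by have [/psdmx_trmxC] := absmxP (Q^t*). Qed.

Let SC : S^t* = S.
Proof.
have [U [d [_ d0 _ ->]]] := absmx_spectral.
rewrite !trmxC_mul trmxCK trmxC_diag ?mulmxA // => i.
by rewrite mxE invr_ge0.
Qed.

(** [T *m S] is Hermitian, and so are both factors; hence they commute. *)
Let ETS : S *m T = E.
Proof. by have [_ _ <- _] := mpinvP T; rewrite trmxC_mul SC TC. Qed.

Let EC : E^t* = E.
Proof. by have [_ _ ->] := mpinvP T. Qed.

Let ET : E *m T = T. Proof. by have [->] := mpinvP T. Qed.
Let TE : T *m E = T. Proof. by rewrite -ETS mulmxA ET. Qed.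
Let SE : S *m E = S. Proof. by have [_ + _ _] := mpinvP T; rewrite mulmxA. Qed.
Let ES : E *m S = S. Proof. by rewrite -{1}ETS; have [_ ->] := mpinvP T. Qed.

Let EE : E *m E = E. Proof. by rewrite mulmxA ET. Qed.

(** The Gram matrix of Q - E Q involves Q only through Q Q^* = T^2, which [E] fixes on both sides,
    so it is zero. *)
Let EQ : E *m Q = Q.
Proof.
apply/eqP; rewrite eq_sym -subr_eq0; apply/eqP/gram_eq0.
rewrite trmxCB trmxC_mul EC mulmxBl !mulmxBr -!(mulmxA E Q) !(mulmxA Q).
by rewrite -absmx_trmxC_sqr -!(mulmxA T T E) TE (mulmxA E T T) ET !subrr.
Qed.

Let QQCSS : Q *m Q^t* *m S *m S = E.
Proof. by rewrite -absmx_trmxC_sqr -(mulmxA T T) TE. Qed.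

(** By [QQCSS], [E] has a left factor Q, which Q fixes by idempotency. *)
Let QE : Q *m E = E.
Proof. by rewrite -{1}QQCSS !mulmxA QQ QQCSS. Qed.

Let EQC : E *m Q^t* = E.
Proof. by rewrite -{1}EC -trmxC_mul QE EC. Qed.

Lemma rank_absmx_proj : \rank E = \rank Q.
Proof.
apply/eqP; rewrite eqn_leq -{1}QE mxrankM_maxl /=.
by rewrite -{1}EQ mxrankM_maxl.
Qed.

Lemma mpinv_idempotent : mpinv Q = Q^t* *m S *m S.
Proof.
apply: penrose_uniq (mpinvP _) _.
have h : Q *m (Q^t* *m S *m S) = E by rewrite !mulmxA QQCSS.
split; rewrite ?h //.
  by rewrite -mulmxA h -!mulmxA SE.
by rewrite !trmxC_mul trmxCK SC !mulmxA.
Qed.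

(** After expansion, both cross terms and the square of Q^+ have trace tr S^2, so a single -tr S^2
    survives. *)
Lemma mxtrace_sub_mpinv (P : 'M[C]_n) : projectionmx P -> P *m Q = Q ->
  \tr ((P - mpinv Q) *m (P - mpinv Q)^t*) = (\rank P)%:R - \tr (S *m S).
Proof.
move=> [/hermsymmxP PC PP] PQ; rewrite mpinv_idempotent.
(* S = E S = Q Q^* S^3 has its range in that of Q, where P acts as the identity. *)
have PS : P *m S = S by rewrite -{1}ES -{1}QQCSS !mulmxA PQ QQCSS ES.
have SP : S *m P = S by rewrite -{1}SC -{1}PC -trmxC_mul PS SC.
have SSQC : S *m S *m Q^t* = S *m S.
  by rewrite -mulmxA -{2}SE -(mulmxA S E) EQC SE.
have h1 : \tr (Q^t* *m S *m S) = \tr (S *m S).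
  by rewrite -mulmxA mxtrace_mulC SSQC.
have h2 : \tr (P *m (S *m S *m Q)) = \tr (S *m S).
  rewrite !mulmxA PS; have := congr1 (fun M => M^t*) SSQC.
  rewrite trmxC_mul trmxCK trmxC_mul SC => h.
  by rewrite mxtrace_mulC h.
have h3 : \tr (Q^t* *m S *m S *m (S *m S *m Q)) = \tr (S *m S).
  rewrite mxtrace_mulC; congr (\tr _).
  transitivity (S *m (S *m T) *m (T *m S) *m S); last first.
    by rewrite ETS SE -mulmxA ES.
  by rewrite !mulmxA -(mulmxA _ Q) -absmx_trmxC_sqr !mulmxA.
rewrite trmxCB PC !trmxC_mul trmxCK SC mulmxA.
rewrite mulmxBl !mulmxBr PP !linearB /= h2 h3 -!mulmxA SP mulmxA h1.
by rewrite mxtrace_idempotent // subrr subr0.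
Qed.

Lemma mxtrace_sub_matched_proj :
  \tr ((matched_proj Q - Q) *m (matched_proj Q - Q)^t*)
  = \tr (T *m T) - \tr T.
Proof.
rewrite /matched_proj; set W := invmx _.
have uT : T + 1%:M \in unitmx by apply: psd_add1_unit; have [] := absmxP (Q^t*).
have WV : W *m (T + 1%:M) = 1%:M by exact: mulVmx.
have VW : (T + 1%:M) *m W = 1%:M by exact: mulmxV.
have WC : W^t* = W.
  by apply: invmx_trmxC; rewrite trmxCD TC trmx1 map_mx1.
have Wcomm (A : 'M[C]_n) : A *m T = T *m A -> W *m A = A *m W.
  move=> AT; rewrite -{1}(mulmx1 A) -VW !mulmxA -(mulmxA W).
  by rewrite mulmxDr AT mulmx1 -{2}(mul1mx A) -mulmxDl mulmxA WV mul1mx.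
have WS : W *m S = S *m W by apply: Wcomm; rewrite ETS.
have WT : W *m T = T *m W by apply: Wcomm.
have QT : Q *m T = T by rewrite -{1}ET mulmxA QE.
have TQC : T *m Q^t* = T by rewrite -{1}TC -trmxC_mul QT TC.
(* The factor T + 1 cancels against [W] and the 2 against [2^-1]; this gives both the idempotency
   and the trace of [m]. *)
have K1 : (T + Q) *m (T + Q^t*) = 2 *: ((T + 1%:M) *m T).
  rewrite mulmxDl !mulmxDr TQC QT -absmx_trmxC_sqr mulmxDl mul1mx.
  by rewrite scaler_nat mulr2n (addrC T (T *m T)).
have two0 : (2 : C) != 0 by rewrite pnatr_eq0.
set m := 2^-1 *: _.
have mE : m = 2^-1 *: ((T + Q^t*) *m (S *m W) *m (T + Q)).
  by rewrite /m !mulmxA.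
have mC : m^t* = m.
  rewrite mE linearZ /= map_mxZ !trmxC_mul !trmxCD SC WC trmxCK TC.
  by rewrite fmorphV rmorph_nat WS !mulmxA.
have mm : m *m m = m.
  rewrite mE -scalemxAl -scalemxAr.
  transitivity (2^-1 *: (2^-1 *: ((T + Q^t*) *m S *m W *m
    ((T + Q) *m (T + Q^t*)) *m (S *m W) *m (T + Q)))).
    by rewrite !mulmxA.
  rewrite K1 -scalemxAr -!scalemxAl !scalerA -mulrA mulVf // mulr1.
  congr (_ *: _); rewrite !mulmxA -(mulmxA _ W (T + 1%:M)) WV mulmx1.
  by rewrite -(mulmxA _ S T) ETS -(mulmxA _ E S) ES.
have trm : \tr m = \tr E.
  rewrite mE linearZ /= -(mulmxA (T + Q^t*)) mxtrace_mulC -(mulmxA (S *m W)) K1.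
  rewrite -scalemxAr linearZ /= mulrA mulVf // mul1r !mulmxA.
  by rewrite -(mulmxA _ W (T + 1%:M)) WV mulmx1 ETS.
have trQm : \tr (Q *m m) = 2^-1 * (\tr T + \tr E).
  rewrite mE -scalemxAr linearZ /= !mulmxA mxtrace_mulC !mulmxA.
  have -> : (T + Q) *m Q *m (T + Q^t*) = (T + 1%:M) *m T *m (T + 1%:M).
    rewrite -mulmxA (mulmxDr Q) QT -absmx_trmxC_sqr.
    have -> : T + T *m T = T *m (T + 1%:M) by rewrite mulmxDr mulmx1 addrC.
    by rewrite mulmxA mulmxDl QT [in RHS]mulmxDl mul1mx.
  rewrite mxtrace_mulC !mulmxA WV mul1mx mulmxDr mulmx1 mulmxDl -(mulmxA T T).
  by rewrite TE linearD.
have trmQC : \tr (m *m Q^t*) = 2^-1 * (\tr T + \tr E).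
  rewrite -mC -trmxC_mul mxtrace_trmxC trQm.
  rewrite -mxtraceD rmorphM /= fmorphV rmorph_nat.
  by rewrite -mxtrace_trmxC trmxCD TC EC.
rewrite trmxCB mC mulmxBl !mulmxBr mm -absmx_trmxC_sqr !linearB /=.
by rewrite trm trQm trmQC; field.
Qed.

(** [T], [S] and [E] are diagonal in one unitary basis, so both sides are sums over the eigenvalues
    of [T], compared term by term. *)
Lemma mxtrace_matched_ineq :
  \tr E - \tr (S *m S) <= 2 * (\tr (T *m T) - \tr T) ?= iff (Q == E).
Proof.
have [U [d [uU d0 eT eS]]] := absmx_spectral.
have UU : U *m U^t* = 1%:M by apply/unitarymxP.
have tr_conj D : \tr (U^t* *m D *m U) = \tr D.
  by rewrite mxtrace_mulC mulmxA UU mul1mx.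
have conjM D D' : (U^t* *m D *m U) *m (U^t* *m D' *m U)
    = U^t* *m (D *m D') *m U.
  by rewrite !mulmxA -(mulmxA _ U) UU mulmx1.
pose x i := d 0 i.
have -> : \tr E - \tr (S *m S) = \sum_i (x i / x i - (x i)^-1 ^+ 2).
  rewrite eS {1}eT !conjM !tr_conj !mulmx_diag !mxtrace_diag -sumrB.
  by apply: eq_bigr => i _; rewrite !mxE expr2.
have -> : 2 * (\tr (T *m T) - \tr T) = \sum_i (2 * (x i ^+ 2 - x i)).
  rewrite eT !conjM !tr_conj !mulmx_diag !mxtrace_diag -sumrB mulr_sumr.
  by apply: eq_bigr => i _; rewrite !mxE expr2.
(* The eigenvalue of [E] is [x i / x i], which is 0 when [x i = 0] and 1 otherwise. The equality
   condition thus reads [x i = 0] or [x i = 1], and zero eigenvalues contribute 0 to both sides. *)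
have leif i : x i / x i - (x i)^-1 ^+ 2 <= 2 * (x i ^+ 2 - x i)
              ?= iff (x i == x i / x i).
  have [->|xi0] := eqVneq (x i) 0.
    by rewrite mul0r invr0 expr0n subrr mulr0 eqxx; apply/leif_refl.
  have xi_gt0 : 0 < x i by rewrite lt_neqAle eq_sym xi0 d0.
  have c_gt0 : 0 < (2 * x i ^+ 2 + 2 * x i + 1) / x i ^+ 2.
    by rewrite divr_gt0 ?exprn_gt0 ?addr_gt0 ?mulr_gt0 ?exprn_gt0.
  have e : 2 * (x i ^+ 2 - x i) - (x i / x i - (x i)^-1 ^+ 2)
      = (x i - 1) ^+ 2 * ((2 * x i ^+ 2 + 2 * x i + 1) / x i ^+ 2) by field.
  have x1r : x i - 1 \is Num.real by rewrite realB ?ger0_real.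
  split.
    by rewrite -subr_ge0 e mulr_ge0 ?(ltW c_gt0) ?real_exprn_even_ge0.
  rewrite eq_sym -subr_eq0 e mulf_eq0 (gt_eqF c_gt0) orbF expf_eq0 /=.
  by rewrite divff // subr_eq0.
have := leif_sum (fun i (_ : true) => leif i).
have -> : [forall (i | true), x i == x i / x i] = (Q == E) => //.
apply/forallP/eqP => [h|QE1].
  (* Termwise equality makes the spectra of [T] and [E] agree in the common basis. Then (Q - E)(Q -
     E)^* = T^2 - E = 0. *)
  have eTE : T = E.
    rewrite eS eT conjM mulmx_diag; congr (_ *m diag_mx _ *m _).
    by apply/rowP => i; rewrite !mxE; have /eqP := h i.
  apply/eqP; rewrite -subr_eq0; apply/eqP/gram_eq0.
  rewrite trmxCB EC mulmxBl !mulmxBr QE EQC EE -absmx_trmxC_sqr.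
  by rewrite {1 2}eTE EE !subrr.
(* Conversely, Q = E gives T^2 = E Q^* = E = E^2, and positive semi-definite square roots are
   unique. *)
have eTE : T = E.
  apply: psd_sqrt_uniq; first by have [] := absmxP (Q^t*).
    by rewrite -EE -{1}EC; exact: psd_gram.
  by rewrite EE absmx_trmxC_sqr (congr1 (mulmx^~ (Q^t*)) QE1) EQC.
move=> i; apply/eqP; move: eTE; rewrite eS {1 2}eT conjM mulmx_diag.
move=> /(congr1 (fun D => U *m D *m U^t*)).
rewrite !mulmxA UU !mul1mx -!(mulmxA _ U) UU !mulmx1.
by move=> /matrixP/(_ i i); rewrite !mxE eqxx !mulr1n.
Qed.

Lemma mulmx_mpinv_idempotent : Q *m mpinv Q = E.
Proof. by rewrite mpinv_idempotent !mulmxA QQCSS. Qed.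

(** Since tr E = rank E = rank Q, the left side is tr E - tr S^2, in which P no longer appears. *)
Lemma mxtrace_sub_mpinv_leif (P : 'M[C]_n) : projectionmx P -> P *m Q = Q ->
  \tr ((P - mpinv Q) *m (P - mpinv Q)^t*) - ((\rank P)%:R - (\rank Q)%:R)
  <= 2 * \tr ((matched_proj Q - Q) *m (matched_proj Q - Q)^t*)
    ?= iff (Q == Q *m mpinv Q).
Proof.
move=> hP PQ; rewrite mxtrace_sub_mpinv // mxtrace_sub_matched_proj.
rewrite mulmx_mpinv_idempotent -rank_absmx_proj -(mxtrace_idempotent E) //.
have -> a b c : a - b - (a - c) = c - b :> C by ring.
exact: mxtrace_matched_ineq.
Qed.

End Idempotent.

(** * Rigidity of orthogonal projections, for the equality case *)

Section Projection.
Context {C : numClosedFieldType}.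

(** Two projections with the same range fix each other's columns: N Q = Q and Q N = N. Taking
    adjoints identifies them. *)
Lemma projection_range_proj {n} (Q : 'M[C]_n) :
  projectionmx Q -> Q = range_proj Q.
Proof.
case=> /hermsymmxP QC QQ; have [[/hermsymmxP NC NN] NQ] := range_projP Q.
set N := range_proj Q in NC NN NQ *.
have NQE : N *m Q = Q.
  have /submxP [D /(congr1 trmx)] : (Q^T <= N^T)%MS by rewrite NQ.
  by rewrite trmx_mul !trmxK => ->; rewrite mulmxA NN.
have QNE : Q *m N = N.
  have /submxP [D /(congr1 trmx)] : (N^T <= Q^T)%MS by rewrite NQ.
  by rewrite trmx_mul !trmxK => ->; rewrite mulmxA QQ.
by rewrite -{1}NQE -{1}NC -{1}QC -trmxC_mul QNE NC.
Qed.

Lemma projection_mpinv {n} (Q : 'M[C]_n) : projectionmx Q -> mpinv Q = Q.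
Proof.
case=> /hermsymmxP QC QQ; apply: penrose_uniq (mpinvP Q) _.
by split; rewrite !QQ.
Qed.

(** The squared Frobenius distance of nested projections is the difference of their ranks. *)
Lemma projection_eq_rank {n} (P Q : 'M[C]_n) :
  projectionmx P -> projectionmx Q -> P *m Q = Q -> \rank P = \rank Q ->
  P = Q.
Proof.
move=> [/hermsymmxP PC PP] [/hermsymmxP QC QQ] PQ rPQ.
have QP : Q *m P = Q by rewrite -{1}QC -{1}PC -trmxC_mul PQ.
apply/eqP; rewrite -subr_eq0; apply/eqP/mxtrace_gram_eq0.
rewrite trmxCB PC QC mulmxBl !mulmxBr PP PQ QP QQ subrr subr0 linearB /=.
by rewrite !mxtrace_idempotent // rPQ subrr.
Qed.

End Projection.

(** * From complex traces to real norms, and the final estimate *)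

Lemma frobenius_norm_sqr (R : realType) m n (A : 'M[R[i]]_(m, n)) :
  (frobenius_norm A ^+ 2)%:C%C = \tr (A *m A^t*).
Proof.
have sq0 (z : R[i]) : 0 <= Normc.normc z ^+ 2 by exact: sqr_ge0.
rewrite sqr_sqrtr; last by apply: sumr_ge0 => i _; apply: sumr_ge0.
rewrite rmorph_sum; apply: eq_bigr => i _; rewrite mxE rmorph_sum.
apply: eq_bigr => j _; rewrite !mxE -normCK rmorphXn.
by congr (_ ^+ 2); case: (A i j).
Qed.

Local Close Scope sesquilinear_scope.

Theorem theorem5p3 (R : realType) (n : nat) (hn : (0 < n)%N)
    (P Q : 'M[R[i]]_n) (hP : projectionmx P) (hQ : idempotentmx Q)
    (hPQ : P *m Q = Q) :
  frobenius_norm (P - mpinv Q) <=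
    Num.sqrt 2
    * Num.sqrt (1 + spectral_norm (mpinv Q *m Q - Q *m mpinv Q) ^+ 2)
    * lambda_PQ P Q
  /\
  (frobenius_norm (P - mpinv Q) =
    Num.sqrt 2
    * Num.sqrt (1 + spectral_norm (mpinv Q *m Q - Q *m mpinv Q) ^+ 2)
    * lambda_PQ P Q
   <-> P = Q /\ Q = range_proj Q).
Proof.
have := mxtrace_sub_mpinv_leif hQ P hP hPQ.
rewrite -!frobenius_norm_sqr /lambda_PQ.
set x := frobenius_norm _; set y := frobenius_norm _; set s := spectral_norm _.
rewrite -(rmorph_nat (real_complex R) (\rank P)).
rewrite -(rmorph_nat (real_complex R) (\rank Q)).
rewrite -(rmorph_nat (real_complex R) 2) -!rmorphB -rmorphM /=.
rewrite -addrA; have k0 : 0 <= (\rank P)%:R - (\rank Q)%:R :> R.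
  by rewrite subr_ge0 ler_nat -hPQ mxrankM_maxl.
set k : R := _ - _ in k0 *.
move=> [le_xy eq_xy]; rewrite lecR in le_xy.
have {}eq_xy : (x ^+ 2 - k == 2 * y ^+ 2) = (Q == Q *m mpinv Q).
  by rewrite -eq_xy (inj_eq (@complexI R)).
have x0 : 0 <= x by exact: sqrtr_ge0.
have y0 : 0 <= y ^+ 2 by exact: sqr_ge0.
have s0 : 0 <= s ^+ 2 by exact: sqr_ge0.
have s1 : 0 <= 1 + s ^+ 2 by rewrite addr_ge0.
have yk0 : 0 <= y ^+ 2 + k by rewrite addr_ge0.
set r := _ * Num.sqrt _.
have r0 : 0 <= r by rewrite !mulr_ge0 ?sqrtr_ge0.
have r2 : r ^+ 2 = 2 * (1 + s ^+ 2) * (y ^+ 2 + k).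
  by rewrite /r !exprMn (sqr_sqrtr yk0) (sqr_sqrtr s1) sqr_sqrtr.
have sl0 : 0 <= s ^+ 2 * (y ^+ 2 + k) by rewrite mulr_ge0.
(* The chain is x^2 <= 2 y^2 + k <= 2 (y^2 + k) <= r^2. *)
split; first by rewrite -(@ler_pXn2r _ 2) ?nnegrE // r2; nra.
split=> [exr|[PQ hR]].
  move: r2; rewrite -exr => x2.
  (* Equality collapses the whole chain: k + 2 s^2 (y^2 + k) <= 0 forces k = 0, and then x^2 = 2
     y^2. *)
  have k_eq0 : k = 0 by nra.
  have {}eq_xy : Q = Q *m mpinv Q by apply/eqP; rewrite -eq_xy; apply/eqP; nra.
  have projQ : projectionmx Q.
    by split=> //; apply/hermsymmxP; have [_ _ + _] := mpinvP Q; rewrite -eq_xy.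
  split; last exact: projection_range_proj.
  apply: projection_eq_rank => //; apply/eqP.
  by rewrite -(eqr_nat R) -subr_eq0 -/k k_eq0.
have projQ : projectionmx Q by rewrite hR; have [] := range_projP Q.
have Q1 := projection_mpinv Q projQ.
have x_eq0 : x = 0.
  apply/eqP; rewrite -sqrf_eq0 -(inj_eq (@complexI R)) frobenius_norm_sqr.
  by rewrite Q1 PQ subrr mul0mx linear0.
have k_eq0 : k = 0 by rewrite /k PQ subrr.
(* Q = Q Q^+ holds for a projection, so the trace inequality is an equality; with x = k = 0 it
   yields y = 0, and both sides of the bound vanish. *)
move: eq_xy; rewrite Q1 hQ eqxx => /eqP xy.
have y_eq0 : y ^+ 2 = 0 by move: xy; rewrite x_eq0 k_eq0; lra.
by apply/eqP; rewrite -(@eqrXn2 _ 2) // r2 x_eq0 y_eq0 k_eq0 addr0 mulr0 expr0n.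
Qed.
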